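(* Let $(a,b,c)$ be a primitive Pythagorean triple and let $A,B\in\{a,b,c\}$ be two different numbers. Then the elliptic curve over $\mathbb{Q}$ $$y^2=x^3-A^2x+B^2$$ has positive rank.
   Context: A primitive Pythagorean triple (PPT) is a triple $(a,b,c)$ of positive integers with $a^2+b^2=c^2$ and $\gcd(a,b,c)=1$. The rank of an elliptic curve $E$ over $\mathbb{Q}$ is the nonnegative integer $r$ such that $E(\mathbb{Q})\cong\mathbb{Z}^r\times E(\mathbb{Q})_{\mathrm{tors}}$. *)

(* Defs.v *)
From HB Require Import structures.
From mathcomp Require Import all_boot all_order all_algebra.
From mathcomp Require Import ring.
Set Implicit Arguments.
Unset Strict Implicit.
Unset Printing Implicit Defensive.
Import Order.TTheory GRing.Theory Num.Theory.
Local Open Scope ring_scope.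

Definition primitive_pythagorean (a b c : nat) : Prop :=
  [/\ (0 < a)%N, (0 < b)%N, (0 < c)%N,
      (a ^ 2 + b ^ 2 = c ^ 2)%N & gcdn (gcdn a b) c = 1%N].

(* The projective cubic y^2 = x^3 + p x + q over the rationals is smooth iff
   its discriminant -16 (4 p^3 + 27 q^2) does not vanish. *)
Definition elliptic (p q : rat) : bool := 4 * p ^+ 3 + 27 * q ^+ 2 != 0.

(* Rational points of the projective curve: [None] is the point at infinity. *)
Definition on_curve (p q : rat) (P : option (rat * rat)) : bool :=
  if P is Some (x, y) then y ^+ 2 == x ^+ 3 + p * x + q else true.

Definition point (p q : rat) : Type :=
  {P : option (rat * rat) | on_curve p q P}.

Definition zero_point (p q : rat) : point p q := exist _ None isT.

(* Chord-and-tangent law. On the curve, x1 = x2 and y1 <> - y2 force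
   y1 = y2 <> 0, which is when the tangent slope is used. *)
Definition add_coords (p : rat) (P Q : option (rat * rat)) :
    option (rat * rat) :=
  match P, Q with
  | None, _ => Q
  | _, None => P
  | Some (x1, y1), Some (x2, y2) =>
      if (x1 == x2) && (y1 == - y2) then None else
      let s := if x1 == x2 then (3 * x1 ^+ 2 + p) / (2 * y1)
               else (y2 - y1) / (x2 - x1) in
      let x3 := s ^+ 2 - x1 - x2 in
      Some (x3, s * (x1 - x3) - y1)
  end.

Lemma on_curve_add (p q : rat) (P Q : option (rat * rat)) :
  on_curve p q P -> on_curve p q Q -> on_curve p q (add_coords p P Q).
Proof.
case: P Q => [[x1 y1]|] [[x2 y2]|] //= /eqP e1 /eqP e2.
have eq : q = y1 ^+ 2 - x1 ^+ 3 - p * x1 by rewrite e1; ring.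
have [ex|nx] := eqVneq x1 x2 => /=.
  have [//|ny] := eqVneq y1 (- y2).
  have ey : y1 = y2.
    apply/eqP; rewrite -subr_eq0.
    have : (y1 - y2) * (y1 + y2) == 0.
      by rewrite -subr_sqr e1 e2 ex subrr.
    by rewrite mulf_eq0 (addr_eq0 y1 y2) (negPf ny) orbF.
  have y0 : y1 != 0.
    by apply: contra ny => /eqP y0; rewrite -ey y0 oppr0.
  by apply/eqP; rewrite /= eq -ex; field.
have dx : x2 - x1 != 0 by rewrite subr_eq0 eq_sym.
have ep : p = (y2 ^+ 2 - y1 ^+ 2 - x2 ^+ 3 + x1 ^+ 3) / (x2 - x1).
  by rewrite e1 e2; field.
by apply/eqP; rewrite /= eq ep; field.
Qed.

Definition add_point (p q : rat) (P Q : point p q) : point p q :=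
  exist _ (add_coords p (sval P) (sval Q))
    (on_curve_add (svalP P) (svalP Q)).

Definition mul_point (p q : rat) (n : nat) (P : point p q) : point p q :=
  iter n (add_point P) (zero_point p q).

Definition torsion_point (p q : rat) (P : point p q) : Prop :=
  exists2 n : nat, (0 < n)%N & mul_point n P = zero_point p q.

(* [has_rank p q r]: the group E(Q) of the curve y^2 = x^3 + p x + q is
   isomorphic to Z^r x E(Q)_tors. The isomorphism is a map f into Z^r x E(Q)
   that is additive, injective, and whose image is Z^r x E(Q)_tors.
   When the curve is elliptic, exactly one r qualifies, by the Mordell-Weil
   theorem. Without that theorem, has_rank p q 0 still says exactly that every
   rational point is torsion (if so, take P |-> (0, P)), so the claim that every
   r with has_rank p q r is positive is never vacuous. *)
Definition has_rank (p q : rat) (r : nat) : Prop :=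
  exists f : point p q -> 'rV[int]_r * point p q,
    [/\ forall P Q, f (add_point P Q) =
          ((f P).1 + (f Q).1, add_point (f P).2 (f Q).2),
        injective f
      & forall v T, torsion_point T <-> exists P, f P = (v, T)].

(* Main.v *)
Require Import Defs.
From HB Require Import structures.
From mathcomp Require Import all_boot all_order all_algebra.
From mathcomp Require Import ring lra zify.
Set Implicit Arguments.
Unset Strict Implicit.
Unset Printing Implicit Defensive.
Import Order.TTheory GRing.Theory Num.Theory.
Local Open Scope ring_scope.

(** The proof is 2-adic; the Pythagorean triple enters through the fact that A
    and B are nonzero and not both even. Let p and q lie in the localization of
    Z at 2. On the curve y^2 = x^3 + p x + q, the coordinates z = x / y and
    w = 1 / y vanish at the origin, and near it the group law is almost addition
    in z: if t is an even element of the local ring such that t divides z and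
    t^3 divides w at P and R, then z(P + R) = z(P) + z(R) up to a multiple of
    4 t ([close_add]). Say that P has exact level t when moreover z(P) / t is a
    2-adic unit. Then z(n P) / t is congruent to n z(P) / t modulo 4, hence
    nonzero for n odd, and 2 P has exact level 2 t ([close_double]). Since
    (2 n) P = n (2 P), descent on n shows that no positive multiple of P
    vanishes ([mul_close_neq0]).

    The equation (2 n) P = n (2 P) rests on the identity
    (P + P) + R = P + (P + R) ([add2_coords]). This case of associativity
    involves two points only. Two points in general position determine p and q,
    so it is an identity between rational functions of free variables.

    It remains to exhibit a point whose exact level is a power of 2. From
    P0 = (0, B), one takes 2 P0 when A is odd ([close_point_odd]) and 3 P0 when
    A is even and B odd ([close_point_even]). Finally, if the rank were 0, every
    rational point would be torsion ([rank0_torsion]). *)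

(** * The chord-and-tangent law *)

Definition opp_coords (P : option (rat * rat)) : option (rat * rat) :=
  if P is Some (x, y) then Some (x, - y) else None.

Lemma opp_coordsK : involutive opp_coords.
Proof. by case=> [[x y]|] //=; rewrite opprK. Qed.

Lemma on_curve_opp p q P : on_curve p q P -> on_curve p q (opp_coords P).
Proof. by case: P => [[x y]|] //=; rewrite sqrrN. Qed.

Lemma add_coords0 p P : add_coords p P None = P.
Proof. by case: P => [[x y]|]. Qed.

Lemma addN_coords p P : add_coords p (opp_coords P) P = None.
Proof. by case: P => [[x y]|] //=; rewrite !eqxx. Qed.

Lemma same_abscissa p q x y1 y2 :
  on_curve p q (Some (x, y1)) -> on_curve p q (Some (x, y2)) ->
  y1 = y2 \/ y1 = - y2.
Proof.
move=> /= /eqP <- /[!eqf_sqr] /orP[] /eqP ->; [by left|right].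
by rewrite opprK.
Qed.

Lemma addC_coords p q P R : on_curve p q P -> on_curve p q R ->
  add_coords p P R = add_coords p R P.
Proof.
case: P R => [[x1 y1]|] [[x2 y2]|] // h1 h2.
have [ex|nx] := eqVneq x1 x2.
  rewrite -ex in h2 *; have [->//|->] := same_abscissa h1 h2.
  by rewrite /= !eqxx opprK eqxx.
rewrite /= (eq_sym x2) (negPf nx) /=.
have d1 : x2 - x1 != 0 by rewrite subr_eq0 eq_sym.
have d2 : x1 - x2 != 0 by rewrite subr_eq0.
by congr (Some (_, _)); field; rewrite ?d1 ?d2.
Qed.

Lemma oppD_coords p P R :
  opp_coords (add_coords p P R) =
  add_coords p (opp_coords P) (opp_coords R).
Proof.
case: P R => [[x1 y1]|] [[x2 y2]|] //=.
rewrite eqr_opp; case: ifP => // _; case: ifP => _ /=.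
  by rewrite mulrN invrN; congr (Some (_, _)); ring.
by congr (Some (_, _)); ring.
Qed.

Lemma add_coords_chord (p x1 y1 x2 y2 s : rat) :
  x1 != x2 -> y2 - y1 = s * (x2 - x1) ->
  let x3 := s ^+ 2 - x1 - x2 in
  add_coords p (Some (x1, y1)) (Some (x2, y2)) =
  Some (x3, s * (x1 - x3) - y1).
Proof.
move=> nx e; rewrite /add_coords (negPf nx) andFb e mulfK //.
by rewrite subr_eq0 eq_sym.
Qed.

Lemma add_coords_tangent (p x y m : rat) :
  y != 0 -> 3 * x ^+ 2 + p = 2 * y * m ->
  let x3 := m ^+ 2 - x - x in
  add_coords p (Some (x, y)) (Some (x, y)) = Some (x3, m * (x - x3) - y).
Proof.
move=> y0 e; have ny : (y == - y) = false.
  by apply/negP => /eqP h; case/eqP: y0; lra.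
by rewrite /add_coords eqxx ny andbF e mulrAC mulfV ?mul1r // mulf_neq0.
Qed.

(** If the cubic x^3 + p x + q - (s x + c)^2 has the roots x1, x2 and
    s^2 - x1 - x2, Vieta's formula for p forces s to be the slope used by the
    group law, for chords and tangents alike. *)
Lemma add_coords_line (p x1 x2 s c : rat) :
  let x3 := s ^+ 2 - x1 - x2 in
  p = x1 * x2 + (x1 + x2) * x3 + 2 * s * c ->
  ~~ ((x1 == x2) && (s * x1 + c == - (s * x2 + c))) ->
  add_coords p (Some (x1, s * x1 + c)) (Some (x2, s * x2 + c)) =
  Some (x3, - (s * x3 + c)).
Proof.
move=> x3 ep nz; rewrite /= (negPf nz).
suff -> : (if x1 == x2 then (3 * x1 ^+ 2 + p) / (2 * (s * x1 + c))
           else (s * x2 + c - (s * x1 + c)) / (x2 - x1)) = s.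
  by congr (Some (_, _)); rewrite /x3; ring.
case: (eqVneq x1 x2) nz => [e2 /= ny|nx _]; last first.
  have d : x2 - x1 != 0 by rewrite subr_eq0 eq_sym.
  by field.
have y0 : s * x1 + c != 0.
  by apply: contra ny => /eqP y0; rewrite -e2 y0 oppr0.
by rewrite ep /x3 -e2; field.
Qed.

(** Two points that are not opposite are parametrized by the line through them:
    by Vieta's formulas, x1, x2, s and c are free and determine p and q. *)
Lemma lineP p q x1 y1 x2 y2 :
  on_curve p q (Some (x1, y1)) -> on_curve p q (Some (x2, y2)) ->
  ~~ ((x1 == x2) && (y1 == - y2)) ->
  exists s c, let x3 := s ^+ 2 - x1 - x2 in
   [/\ y1 = s * x1 + c, y2 = s * x2 + c,
     p = x1 * x2 + (x1 + x2) * x3 + 2 * s * c,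
     q = c ^+ 2 - x1 * x2 * x3 &
     add_coords p (Some (x1, y1)) (Some (x2, y2)) =
       Some (x3, - (s * x3 + c))].
Proof.
move=> h1 h2 nz.
pose s := if x1 == x2 then (3 * x1 ^+ 2 + p) / (2 * y1)
          else (y2 - y1) / (x2 - x1).
pose c := y1 - s * x1; pose x3 := s ^+ 2 - x1 - x2.
have e1 : y1 = s * x1 + c by rewrite /c; ring.
have [e2 ep] : y2 = s * x2 + c /\ p = x1 * x2 + (x1 + x2) * x3 + 2 * s * c.
  rewrite /x3 /c /s; case: (eqVneq x1 x2) nz h2 => [<- /= ny h2|nx _ h2].
    have ey : y1 = y2.
      by have [//|ey] := same_abscissa h1 h2; rewrite ey eqxx in ny.
    have y0 : y1 != 0.
      by apply: contra ny => /eqP y0; rewrite -ey y0 oppr0.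
    by split; [rewrite -ey|]; field.
  have d : x2 - x1 != 0 by rewrite subr_eq0 eq_sym.
  move: h1 h2 => /= /eqP h1 /eqP h2.
  have -> : p = (y2 ^+ 2 - y1 ^+ 2 - x2 ^+ 3 + x1 ^+ 3) / (x2 - x1).
    by rewrite h1 h2; field.
  by split; field.
exists s, c; split => //.
  move: h1 => /= /eqP h1.
  have -> : q = y1 ^+ 2 - x1 ^+ 3 - p * x1 by rewrite h1; ring.
  by rewrite ep e1 /x3; ring.
by rewrite [in LHS]e1 [in LHS]e2 add_coords_line // -e1 -e2.
Qed.

(** If the line y = s x + c goes through P, R and - (P + R), its mirror image
    goes through - P, P + R and - R. *)
Lemma addK_coords p q P R : elliptic p q -> on_curve p q P -> on_curve p q R ->
  add_coords p (opp_coords P) (add_coords p P R) = R.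
Proof.
move=> ell; case: P => [[x1 y1]|] //; case: R => [[x2 y2]|] h1 h2; last first.
  by rewrite add_coords0 addN_coords.
have [/andP[/eqP ex /eqP ey]|nz] := boolP ((x1 == x2) && (y1 == - y2)).
  by rewrite /= ex ey !eqxx /= opprK.
have [s [c [e1 e2 ep eq ->]]] := lineP h1 h2 nz.
set x3 := s ^+ 2 - x1 - x2 in ep eq *.
have -> : - (s * x3 + c) = (- s) * x3 + (- c) by ring.
rewrite [opp_coords _]/= e1.
have -> : - (s * x1 + c) = (- s) * x1 + (- c) by ring.
rewrite add_coords_line; first by congr (Some (_, _)); rewrite ?e2 /x3; ring.
  by rewrite ep /x3; ring.
(* The chord through P and R cannot be tangent to the curve at a point of
   ordinate 0: there the tangent is vertical, unless the cubic has a double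
   root. *)
apply/negP => /andP[/eqP e13 /eqP ey].
have y0 : s * x1 + c = 0 by rewrite -e13 in ey; lra.
move/negP: ell; apply; apply/eqP.
have ec : c = - s * x1 by lra.
have e2' : x2 = s ^+ 2 - x1 - x1 by move: e13; rewrite /x3; lra.
by rewrite ep eq -e13 e2' ec; ring.
Qed.

(** The case in which only chords occur after the first doubling. Once the
    slopes s of P R and m of the tangent at P are taken as variables, y1 is a
    rational function of x1, x2, s, m and the claim is an identity in these. *)
Lemma add2_chord p q x1 y1 x2 y2 s m :
  on_curve p q (Some (x1, y1)) -> on_curve p q (Some (x2, y2)) ->
  let P := Some (x1, y1) in let R := Some (x2, y2) in
  y1 != 0 -> x1 != x2 ->
  y2 - y1 = s * (x2 - x1) -> 3 * x1 ^+ 2 + p = 2 * y1 * m ->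
  x1 != s ^+ 2 - x1 - x2 -> m ^+ 2 - x1 - x1 != x2 ->
  add_coords p (add_coords p P P) R = add_coords p P (add_coords p P R).
Proof.
move=> h1 h2 P R y0 nx es em n3 n4.
have d : x2 - x1 != 0 by rewrite subr_eq0 eq_sym.
have d3 : s ^+ 2 - x1 - x2 - x1 != 0 by rewrite subr_eq0 eq_sym.
have d4 : x2 - (m ^+ 2 - x1 - x1) != 0 by rewrite subr_eq0 eq_sym.
have e2 : y2 = y1 + s * (x2 - x1) by rewrite -es; ring.
have ep : p = s * (2 * y1 + s * (x2 - x1)) - (x1 ^+ 2 + x1 * x2 + x2 ^+ 2).
  move: h1 h2; rewrite /on_curve => /eqP h1 /eqP h2.
  have -> : p = (y2 ^+ 2 - y1 ^+ 2 - x2 ^+ 3 + x1 ^+ 3) / (x2 - x1).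
    by rewrite h1 h2; field.
  by rewrite e2; field.
have ey : 2 * y1 * (m - s) = (x2 - x1) * (s ^+ 2 - x1 - x2 - x1).
  by rewrite mulrBr -em ep; ring.
have dm : m - s != 0.
  by apply: contraNneq (mulf_neq0 d d3) => h; rewrite -ey h mulr0.
have e1 : y1 = (x2 - x1) * (s ^+ 2 - x1 - x2 - x1) / (2 * (m - s)).
  by rewrite -ey; field.
rewrite (add_coords_tangent y0 em) (add_coords_chord _ nx es).
set y3 := s * (x1 - (s ^+ 2 - x1 - x2)) - y1.
set y4 := m * (x1 - (m ^+ 2 - x1 - x1)) - y1.
rewrite (@add_coords_chord _ _ y4 _ y2
  ((y2 - y4) / (x2 - (m ^+ 2 - x1 - x1)))) //; last by rewrite divfK.
rewrite (@add_coords_chord _ _ y1 _ y3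
  ((y3 - y1) / (s ^+ 2 - x1 - x2 - x1))) //; last by rewrite divfK.
by congr (Some (_, _)); rewrite /y3 /y4 e2 e1; field; rewrite ?d ?dm ?d3 ?d4.
Qed.

(** The case R = P + P: the left-hand side doubles P + P. Here x1, the slope m
    of the tangent at P and the slope s of the chord from P to P + P are free. *)
Lemma add2_tangent p x1 y1 m :
  let P := Some (x1, y1) in
  let x2 := m ^+ 2 - x1 - x1 in
  let y2 := m * (x1 - x2) - y1 in
  let R := Some (x2, y2) in
  forall s, y1 != 0 -> y2 != 0 -> x1 != x2 ->
  y2 - y1 = s * (x2 - x1) -> 3 * x1 ^+ 2 + p = 2 * y1 * m ->
  x1 != s ^+ 2 - x1 - x2 ->
  add_coords p (add_coords p P P) R = add_coords p P (add_coords p P R).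
Proof.
move=> P x2 y2 R s y0 y20 nx es em n3.
have d : x2 - x1 != 0 by rewrite subr_eq0 eq_sym.
have d3 : s ^+ 2 - x1 - x2 - x1 != 0 by rewrite subr_eq0 eq_sym.
rewrite (add_coords_tangent y0 em) -/x2 -/y2 -/R (add_coords_chord _ nx es).
have ep : p = 2 * y1 * m - 3 * x1 ^+ 2 by rewrite -em; ring.
rewrite (@add_coords_tangent _ _ _ ((3 * x2 ^+ 2 + p) / (2 * y2))) //;
  last by field.
set y3 := s * (x1 - (s ^+ 2 - x1 - x2)) - y1.
rewrite (@add_coords_chord _ _ y1 _ y3
  ((y3 - y1) / (s ^+ 2 - x1 - x2 - x1))) //; last by rewrite divfK.
have e1 : y1 = (s + m) * (x1 - x2) / 2.
  have -> : (s + m) * (x1 - x2) = m * (x1 - x2) - s * (x2 - x1) by ring.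
  by rewrite -es /y2; field.
have e2 : y2 = (m - s) * (x1 - x2) / 2.
  by rewrite {1}/y2 {1}e1; field.
have dm : m - s != 0.
  by apply: contraNneq y20 => h; rewrite e2 h !mul0r.
have d' : x1 - x2 != 0 by rewrite subr_eq0.
congr (Some (_, _)); rewrite /y3 ep e2 e1; move: d d' d3;
  by rewrite /x2 => d d' d3; field; rewrite ?dm ?d ?d' ?d3.
Qed.

Lemma eq_abscissa p q x1 y1 x2 y2 :
  on_curve p q (Some (x1, y1)) -> on_curve p q (Some (x2, y2)) -> x1 = x2 ->
  Some (x2, y2) = Some (x1, y1) \/ Some (x2, y2) = opp_coords (Some (x1, y1)).
Proof.
move=> h1 h2 ex; rewrite -ex in h2 *.
by have [->|->] := same_abscissa h2 h1; [left | right].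
Qed.

(** The degenerate configurations, where R is P, - P or - (P + P), or P has
    order 2, follow from commutativity and the cancellation law [addK_coords].
    Otherwise P + R differs from P and - P, and [add2_chord] or, if R = P + P,
    [add2_tangent] applies. *)
Lemma add2_coords p q P R : elliptic p q -> on_curve p q P -> on_curve p q R ->
  add_coords p (add_coords p P P) R = add_coords p P (add_coords p P R).
Proof.
move=> ell hP hR; have hNP := on_curve_opp hP; have hPP := on_curve_add hP hP.
have opp_case : R = add_coords p (opp_coords P) (opp_coords P) ->
    add_coords p (add_coords p P P) R = add_coords p P (add_coords p P R).
  move=> eR; have -> : add_coords p P R = opp_coords P.
    by have := addK_coords ell hNP hNP; rewrite opp_coordsK -eR.
  rewrite eR -oppD_coords (addC_coords hPP (on_curve_opp hPP)) addN_coords.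
  by rewrite (addC_coords hP hNP) addN_coords.
have [->|nRP] := eqVneq R P; first exact: addC_coords hPP hP.
have [eR|nRN] := eqVneq R (opp_coords P).
  rewrite eR (addC_coords hPP hNP) (addK_coords ell hP hP).
  by rewrite (addC_coords hP hNP) addN_coords add_coords0.
have [eR|nR2] := eqVneq R (opp_coords (add_coords p P P)).
  by apply: opp_case; rewrite -oppD_coords.
move: hP hNP hPP hR nRP nRN nR2 {opp_case}.
case: P => [[x1 y1]|] //; case: R => [[x2 y2]|] hP hNP hPP hR nRP nRN nR2;
  last by rewrite !add_coords0.
have nx : x1 != x2.
  apply/negP => /eqP ex.
  by have [/eqP|/eqP] := eq_abscissa hP hR ex; apply/negP.
have d : x2 - x1 != 0 by rewrite subr_eq0 eq_sym.
have [y0|y0] := eqVneq y1 0.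
  have -> : add_coords p (Some (x1, y1)) (Some (x1, y1)) = None.
    by rewrite /add_coords y0 oppr0 !eqxx.
  have {1}-> : Some (x1, y1) = opp_coords (Some (x1, y1)).
    by rewrite /= y0 oppr0.
  by rewrite (addK_coords ell).
pose s := (y2 - y1) / (x2 - x1); pose m := (3 * x1 ^+ 2 + p) / (2 * y1).
have es : y2 - y1 = s * (x2 - x1) by rewrite /s divfK.
have em : 3 * x1 ^+ 2 + p = 2 * y1 * m.
  by rewrite /m [RHS]mulrC divfK // mulf_neq0.
have hS := on_curve_add hP hR; have hK := addK_coords ell hP hR.
have eS := add_coords_chord p nx es; have eT := add_coords_tangent y0 em.
rewrite eS in hS hK; rewrite eT in nR2 hPP.
set x3 := s ^+ 2 - _ - _ in hS hK; set x4 := m ^+ 2 - _ - _ in nR2 hPP.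
set y3 := s * _ - _ in hS hK; set y4 := m * _ - _ in nR2 hPP.
have n3 : x1 != x3.
  apply/negP => /eqP e3; have [e|e] := eq_abscissa hP hS e3.
    by move: hK; rewrite e addN_coords.
  move: hK; rewrite e -oppD_coords eT => eR.
  by rewrite -eR -/x4 -/y4 eqxx in nR2.
have [e4|n4] := eqVneq x4 x2; last first.
  exact: (add2_chord hP hR y0 nx es em n3 n4).
have [eR|/eqP eR] := eq_abscissa hPP hR e4; last by rewrite (negPf nR2) in eR.
case: eR => ex ey; have ny : y4 != 0.
  by apply: contraNneq nR2 => h; rewrite ex ey /= h oppr0.
move: nx es n3; rewrite /x3 ex ey => nx es n3.
exact: (add2_tangent y0 ny nx es em n3).
Qed.

(** * Multiples of a point *)

Definition mul_coords (p : rat) (n : nat) (P : option (rat * rat)) :=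
  iter n (add_coords p P) None.

Lemma on_curve_mul p q n P : on_curve p q P -> on_curve p q (mul_coords p n P).
Proof. by move=> hP; elim: n => //= n IH; apply: on_curve_add. Qed.

Lemma mul_coords_double p q n P : elliptic p q -> on_curve p q P ->
  mul_coords p n.*2 P = mul_coords p n (add_coords p P P).
Proof.
move=> ell hP; elim: n => // n IH.
by rewrite doubleS /mul_coords !iterS -!/(mul_coords _ _ _) IH
  (add2_coords ell) // on_curve_mul // on_curve_add.
Qed.

(** * The local ring of the rationals at 2 *)

Lemma odd_intr_neq0 (m : int) : odd `|m| -> m%:~R != 0 :> rat.
Proof. by move=> om; rewrite intr_eq0; apply: contraTneq om => ->. Qed.

Definition local2 : {pred rat} := [pred r | odd `|denq r|%N].

Lemma local2P (r : rat) :
  reflect (exists n m : int, odd `|m| /\ r = n%:~R / m%:~R) (r \in local2).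
Proof.
apply: (iffP idP) => [h|[n [m [om er]]]].
  by exists (numq r), (denq r); rewrite divq_num_den.
have m0 := odd_intr_neq0 om.
have e : numq r * m = n * denq r.
  apply/eqP; rewrite -(eqr_int rat) !rmorphM /= numqE er.
  by rewrite mulrAC divfK.
have : (`|denq r| %| `|m|)%N.
  have := coprime_num_den r; rewrite coprime_sym => cp.
  by rewrite -(Gauss_dvdr _ cp) -abszM e abszM dvdn_mull.
by move=> /dvdn_odd; apply.
Qed.

Lemma local2_subring : subring_closed local2.
Proof.
split.
- by [].
- move=> r s /local2P[n [m [om ->]]] /local2P[n' [m' [om' ->]]].
  apply/local2P; exists (n * m' - n' * m), (m * m').
  rewrite abszM oddM om om'; split=> //.
  have m0 := odd_intr_neq0 om.
  have m0' := odd_intr_neq0 om'.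
  by rewrite !rmorphB !rmorphM /=; field; rewrite m0 m0'.
move=> r s /local2P[n [m [om ->]]] /local2P[n' [m' [om' ->]]].
apply/local2P; exists (n * n'), (m * m').
by rewrite abszM oddM om om' !rmorphM /= invfM mulrACA.
Qed.

HB.instance Definition _ :=
  GRing.isSubringClosed.Build rat local2 local2_subring.

(** The residue field has two elements, so every unit is congruent to 1. *)
Definition unit2 : {pred rat} := [pred u | (u - 1) / 2 \in local2].

Lemma unit2P u :
  reflect (exists2 r, r \in local2 & u = 1 + 2 * r) (u \in unit2).
Proof.
apply: (iffP idP) => [h|[r hr ->]].
  by exists ((u - 1) / 2); [exact: h|field].
by rewrite inE; have -> : (1 + 2 * r - 1) / 2 = r by field.
Qed.

Lemma local2_unit u : u \in unit2 -> u \in local2.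
Proof.
by case/unit2P => r hr ->; rewrite !(rpredD, rpredM) ?rpred1 ?rpred_nat.
Qed.

Lemma unit2D u r : u \in unit2 -> r \in local2 -> u + 2 * r \in unit2.
Proof.
case/unit2P => s hs -> hr; apply/unit2P; exists (s + r); first exact: rpredD.
by ring.
Qed.

Lemma unit2M u v : u \in unit2 -> v \in unit2 -> u * v \in unit2.
Proof.
case/unit2P => r hr -> /unit2P[s hs ->]; apply/unit2P.
exists (r + s + 2 * r * s); first by rewrite !(rpredD, rpredM) ?rpred_nat.
by ring.
Qed.

Lemma unit2_neq0 u : u \in unit2 -> u != 0.
Proof.
case/unit2P => _ /local2P[n [m [om ->]]] ->.
have m0 := odd_intr_neq0 om.
apply/eqP => h; have : (m + 2 * n)%:~R = 0 :> rat.
  by rewrite rmorphD rmorphM /= -(mul0r m%:~R) -h; field.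
by move/eqP; rewrite intr_eq0 => /eqP; lia.
Qed.

Lemma unit2V u : u \in unit2 -> u^-1 \in unit2.
Proof.
move=> hu; have u0 := unit2_neq0 hu.
case/unit2P: hu u0 => _ /local2P[n [m [om ->]]] -> u0; apply/unit2P.
have m0 := odd_intr_neq0 om.
have d0 : m%:~R + 2 * n%:~R != 0 :> rat.
  by apply: contraNneq u0 => h; rewrite -(mulfK m0 (_ + _)) mulrDl mul1r
    -mulrA divfK // h mul0r.
exists (- n%:~R / (m + 2 * n)%:~R).
  apply/local2P; exists (- n), (m + 2 * n); rewrite rmorphN; split=> //; lia.
by rewrite rmorphD rmorphM /=; field; rewrite m0 d0.
Qed.

Lemma unit2_odd (n : nat) : odd n -> n%:R \in unit2.
Proof.
move=> on; apply/unit2P; exists (n./2)%:R; first exact: rpred_nat.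
by rewrite -[in LHS](odd_double_half n) on natrD -mul2n natrM.
Qed.

(** * Points close to the origin 2-adically *)

(** The coordinates z = x / y and w = 1 / y at the origin, rescaled to z / t and
    w / t^3; this replaces the curve by y^2 = x^3 + p t^4 x + q t^6. *)
Definition zeta (t : rat) (P : option (rat * rat)) : rat :=
  if P is Some (x, y) then x / (y * t) else 0.

Definition omega (t : rat) (P : option (rat * rat)) : rat :=
  if P is Some (x, y) then (y * t ^+ 3)^-1 else 0.

(** The last condition excludes the points of order 2, whose coordinates z and w
    are infinite but would read 0 because 0 is its own inverse. *)
Definition close (t : rat) (P : option (rat * rat)) : Prop :=
  [/\ zeta t P \in local2, omega t P \in local2 &
      if P is Some (_, y) then y != 0 else true].

(** The line y = s x + c is w = l z + n with l = - s / (c t^2) and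
    n = 1 / (c t^3) in the rescaled coordinates. Subtracting the equations
    w = z^3 + a z w^2 + b w^3 of its two points gives l = N / D, which is also
    right for tangents; D is a unit near the origin, so l is integral there. *)
Lemma line_param (x1 x2 s c t : rat) :
  let x3 := s ^+ 2 - x1 - x2 in
  let y1 := s * x1 + c in let y2 := s * x2 + c in
  let a := (x1 * x2 + (x1 + x2) * x3 + 2 * s * c) * t ^+ 4 in
  let b := (c ^+ 2 - x1 * x2 * x3) * t ^+ 6 in
  let z1 := x1 / (y1 * t) in let w1 := (y1 * t ^+ 3)^-1 in
  let z2 := x2 / (y2 * t) in let w2 := (y2 * t ^+ 3)^-1 in
  let N := z1 ^+ 2 + z1 * z2 + z2 ^+ 2 + a * w2 ^+ 2 in
  let D := 1 - (a * z1 * (w1 + w2) + b * (w1 ^+ 2 + w1 * w2 + w2 ^+ 2)) in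
  t != 0 -> y1 != 0 -> y2 != 0 ->
  c * t ^+ 2 * N = - s * D.
Proof.
move=> x3 y1 y2 a b z1 w1 z2 w2 N D t0 y10 y20.
rewrite /N /D /z1 /w1 /z2 /w2 /a /b /x3 /y1 /y2.
by field; rewrite ?t0 ?y10 ?y20.
Qed.

(** Substituting w = l z + n into w = z^3 + a z w^2 + b w^3 gives a cubic in z
    of leading coefficient d; the sum of its three roots yields z at the third
    point. The product y1 y2 y3 equals - c^3 d, which keeps y3 away from 0. *)
Lemma third_point (x1 x2 s c t : rat) :
  let x3 := s ^+ 2 - x1 - x2 in
  let y1 := s * x1 + c in let y2 := s * x2 + c in
  let y3 := - (s * x3 + c) in
  let a := (x1 * x2 + (x1 + x2) * x3 + 2 * s * c) * t ^+ 4 in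
  let b := (c ^+ 2 - x1 * x2 * x3) * t ^+ 6 in
  let l := - s / (c * t ^+ 2) in let n := (c * t ^+ 3)^-1 in
  let d := 1 + a * l ^+ 2 + b * l ^+ 3 in
  t != 0 -> c != 0 -> y1 != 0 -> y2 != 0 -> d != 0 ->
  [/\ y3 != 0,
    x3 / (y3 * t) = x1 / (y1 * t) + x2 / (y2 * t) +
       (2 * a * l * n + 3 * b * l ^+ 2 * n) / d &
    (y3 * t ^+ 3)^-1 = l * (x3 / (y3 * t)) - n].
Proof.
move=> x3 y1 y2 y3 a b l n d t0 c0 y10 y20 d0.
have e : y1 * y2 * y3 = - c ^+ 3 * d.
  by rewrite /y1 /y2 /y3 /d /a /b /l /x3; field; rewrite ?t0 ?c0.
have y30 : y3 != 0.
  apply: contra_neq (mulf_neq0 (expf_neq0 3 c0) d0) => h.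
  by apply: oppr_inj; rewrite -mulNr -e h mulr0 oppr0.
split=> //; last first.
  rewrite /l /n; move: y30; rewrite /y3 oppr_eq0 => y30.
  by field; rewrite ?t0 ?c0 ?y30.
have -> : d = - y1 * y2 * y3 / c ^+ 3.
  by rewrite !mulNr e !mulNr opprK mulrC mulKf // expf_neq0.
rewrite /a /b /l /n; move: y10 y20 y30; rewrite /y1 /y2 /y3 /x3 oppr_eq0.
by move=> y10 y20 y30; field; rewrite ?t0 ?c0 ?y10 ?y20 ?y30.
Qed.

Ltac in_local2 :=
  repeat first [ assumption | match goal with
  | |- is_true (_ + _ \in _) => apply: rpredD
  | |- is_true (- _ \in _) => rewrite rpredN
  | |- is_true (_ ^+ _ \in _) => apply: rpredX
  | |- is_true (_ * _ \in _) => apply: rpredM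
  | |- is_true (1 \in _) => exact: rpred1
  | |- is_true (_%:R \in _) => exact: rpred_nat
  end ].

(** The correction term in [third_point] is a multiple of a = p t^4 and
    b = q t^6, which are divisible by 4 because t is even. *)
Lemma close_add p q t P R : p \in local2 -> q \in local2 ->
  t != 0 -> t / 2 \in local2 ->
  on_curve p q P -> on_curve p q R -> close t P -> close t R ->
  close t (add_coords p P R) /\
  exists2 e, e \in local2 &
    zeta t (add_coords p P R) = zeta t P + zeta t R + 4 * e.
Proof.
move=> hp hq t0 ht hP hR cP cR.
case: P R hP hR cP cR => [[x1 y1]|] [[x2 y2]|] hP hR cP cR.
- have [/andP[/eqP ex /eqP ey]|nz] := boolP ((x1 == x2) && (y1 == - y2)).
    have -> : add_coords p (Some (x1, y1)) (Some (x2, y2)) = None.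
      by rewrite /add_coords ex ey !eqxx.
    split; first by split; rewrite ?rpred0.
    exists 0; first exact: rpred0.
    by rewrite /= ex ey mulNr invrN mulrN mulr0 addr0 addNr.
  have [s [c [e1 e2 ep eq ->]]] := lineP hP hR nz.
  case: cP cR => z1P w1P y10 [z2P w2P y20]; rewrite /= in z1P w1P z2P w2P.
  have := @line_param x1 x2 s c t; have := @third_point x1 x2 s c t.
  cbv zeta.
  set x3 := s ^+ 2 - x1 - x2 in ep eq *.
  rewrite -e1 -e2 -ep -eq => /(_ t0) third /(_ t0 y10 y20) line.
  have [a' a'P ea] : exists2 a', a' \in local2 & p * t ^+ 4 = 4 * a'.
    by exists (4 * p * (t / 2) ^+ 4); [in_local2|field].
  have [b' b'P eb] : exists2 b', b' \in local2 & q * t ^+ 6 = 4 * b'.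
    by exists (16 * q * (t / 2) ^+ 6); [in_local2|field].
  rewrite ea eb in third line.
  set N := (X in c * t ^+ 2 * X) in line; set D := (X in - s * X) in line.
  have NP : N \in local2 by rewrite /N; in_local2.
  have DP : D \in unit2.
    apply/unit2P; exists (- 2 * (a' * (x1 / (y1 * t)) *
        ((y1 * t ^+ 3)^-1 + (y2 * t ^+ 3)^-1) +
      b' * ((y1 * t ^+ 3)^-1 ^+ 2 + (y1 * t ^+ 3)^-1 / (y2 * t ^+ 3) +
        (y2 * t ^+ 3)^-1 ^+ 2))); first by in_local2.
    by rewrite /D; ring.
  have D0 := unit2_neq0 DP.
  have c0 : c != 0.
    apply: contraNneq y10 => c0.
    move: line; rewrite c0 !mul0r => /esym/eqP.
    rewrite mulf_eq0 (negPf D0) orbF oppr_eq0 e1 c0 => /eqP->.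
    by rewrite mul0r addr0.
  move: third; set l := - s / (c * t ^+ 2); set n := (c * t ^+ 3)^-1.
  have el : l = N / D.
    apply/eqP; rewrite /l eqr_div ?mulf_neq0 ?expf_neq0 //.
    by rewrite -line mulrC.
  have lP : l \in local2 by rewrite el rpredM // local2_unit // unit2V.
  have en : n = (y1 * t ^+ 3)^-1 - l * (x1 / (y1 * t)).
    by move: y10; rewrite /n /l e1 => y10; field; rewrite t0 c0 y10.
  have nP : n \in local2 by rewrite en; in_local2.
  set d := 1 + _ + _.
  have dP : d \in unit2.
    apply/unit2P; exists (2 * (a' * l ^+ 2 + b' * l ^+ 3)); first by in_local2.
    by rewrite /d; ring.
  move=> /(_ c0 y10 y20 (unit2_neq0 dP)) [y30 ez ew].
  have [e eP ee] : exists2 e, e \in local2 &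
      zeta t (Some (x3, - (s * x3 + c))) =
      zeta t (Some (x1, y1)) + zeta t (Some (x2, y2)) + 4 * e.
    exists ((2 * a' * l * n + 3 * b' * l ^+ 2 * n) / d).
      by rewrite rpredM ?(local2_unit (unit2V dP)) //; in_local2.
    by rewrite /zeta ez; congr (_ + _); ring.
  have zP : zeta t (Some (x3, - (s * x3 + c))) \in local2.
    by rewrite ee /zeta; in_local2.
  split; last by exists e.
  by split=> //; rewrite /omega ew; in_local2.
- split; rewrite add_coords0 //; exists 0; first exact: rpred0.
  by rewrite mulr0 !addr0.
- by split=> //; exists 0; [exact: rpred0|rewrite mulr0 add0r addr0].
by split=> //; exists 0; [exact: rpred0|rewrite /= mulr0 !addr0].
Qed.

Lemma close_mul p q t P n : p \in local2 -> q \in local2 ->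
  t != 0 -> t / 2 \in local2 -> on_curve p q P -> close t P ->
  close t (mul_coords p n P) /\
  exists2 e, e \in local2 &
    zeta t (mul_coords p n P) = n%:R * zeta t P + 4 * e.
Proof.
move=> hp hq t0 ht hP cP; elim: n => [|n [cn [e eP en]]].
  split; first by split; rewrite ?rpred0.
  by exists 0; [exact: rpred0|rewrite mul0r mulr0 addr0].
have [cS [f fP ef]] := close_add hp hq t0 ht hP (on_curve_mul n hP) cP cn.
split=> //; exists (e + f); first exact: rpredD.
by rewrite [LHS]ef en -[in RHS]addn1 natrD; ring.
Qed.

(** Only w needs care: that 8 divides its value at 2 P comes from
    w (1 - a z w - b w^2) = z^3, where z is even and the second factor on the
    left is a unit. *)
Lemma close_double p q t P : p \in local2 -> q \in local2 ->
  t != 0 -> t / 2 \in local2 -> on_curve p q P -> close t P ->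
  zeta t P \in unit2 ->
  close (2 * t) (add_coords p P P) /\ zeta (2 * t) (add_coords p P P) \in unit2.
Proof.
move=> hp hq t0 ht hP cP uP.
have [cS [e eP ee]] := close_add hp hq t0 ht hP hP cP cP.
have hS := on_curve_add hP hP.
have uS : zeta t P + 2 * e \in unit2 by apply: unit2D.
have eS : zeta t (add_coords p P P) = 2 * (zeta t P + 2 * e).
  by rewrite ee; ring.
move: uS eS; set z := zeta t P + 2 * e => uS eS.
move: (add_coords p P P) cS hS eS => [[x y]|] [zS wS y0] hS eS; last first.
  by case/eqP: (unit2_neq0 uS); move: eS; rewrite /=; lra.
have ez : zeta (2 * t) (Some (x, y)) = z.
  rewrite -[RHS](mulKf (_ : 2 != 0)) // -eS /=; field.
  by rewrite t0 y0.
suff wP : omega (2 * t) (Some (x, y)) \in local2.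
  by split; rewrite ?ez //; split; rewrite ?ez // local2_unit.
pose w := omega t (Some (x, y)).
pose u := 1 + 2 * (- 8 * p * (t / 2) ^+ 4 * (2 * z) * w
   - 32 * q * (t / 2) ^+ 6 * w ^+ 2).
have uP' : u \in unit2.
  have zP := local2_unit uS.
  by apply/unit2P; eexists; last reflexivity; in_local2.
have ew : w * u = (2 * z) ^+ 3.
  rewrite /u /w -eS /zeta /omega; move: hS; rewrite /on_curve => /eqP hS.
  have -> : q = y ^+ 2 - x ^+ 3 - p * x by rewrite hS; ring.
  by field; rewrite y0 t0.
have -> : omega (2 * t) (Some (x, y)) = z ^+ 3 / u.
  have -> : z ^+ 3 / u = (2 * z) ^+ 3 / u / 8.
    by move: (u^-1) => v; field.
  rewrite -ew mulfK ?unit2_neq0 // /w /omega.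
  by field; rewrite y0 t0.
by have := local2_unit uS; have := local2_unit (unit2V uP') => ? ?; in_local2.
Qed.

(** Descent on n: for n odd, z(n P) is t times a unit; an even n is halved while
    P is doubled. *)
Lemma mul_close_neq0 p q t P n : elliptic p q ->
  p \in local2 -> q \in local2 ->
  t != 0 -> t / 2 \in local2 -> on_curve p q P -> close t P ->
  zeta t P \in unit2 -> (0 < n)%N -> mul_coords p n P <> None.
Proof.
move=> ell hp hq; elim/ltn_ind: n t P => n IH t P t0 ht hP cP uP n0.
have [on|en] := boolP (odd n).
  have [_ [e eP ee]] := close_mul n hp hq t0 ht hP cP => en.
  have : n%:R * zeta t P + 2 * (2 * e) \in unit2.
    by apply: unit2D; [rewrite unit2M ?unit2_odd|in_local2].
  move/unit2_neq0; rewrite mulrA -ee; last by rewrite en eqxx.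
have [c2 u2] := close_double hp hq t0 ht hP cP uP.
have e2 : n = n./2.*2 by rewrite -[LHS](odd_double_half n) (negPf en).
rewrite e2 (mul_coords_double _ ell hP).
apply: (IH _ _ (2 * t)) => //.
- by lia.
- by rewrite mulf_neq0.
- by rewrite mulrC mulKf //; have -> : t = 2 * (t / 2); [field|in_local2].
- exact: on_curve_add.
by lia.
Qed.

(** * A starting point *)

(** Levels are read off the rescaled coordinates z and w, so the starting points
    are given by these. *)
Lemma close_point p q t z w : t != 0 -> w != 0 -> w \in local2 ->
  z \in unit2 -> w = z ^+ 3 + p * t ^+ 4 * z * w ^+ 2 + q * t ^+ 6 * w ^+ 3 ->
  exists P, [/\ on_curve p q P, close t P & zeta t P \in unit2].
Proof.
move=> t0 w0 wP zP e.
have ez : zeta t (Some (z / (w * t ^+ 2), (w * t ^+ 3)^-1)) = z.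
  by rewrite /zeta; field; rewrite t0 w0.
have ew : omega t (Some (z / (w * t ^+ 2), (w * t ^+ 3)^-1)) = w.
  by rewrite /omega; field; rewrite t0 w0.
exists (Some (z / (w * t ^+ 2), (w * t ^+ 3)^-1)); split; last by rewrite ez.
  have -> : q = (w - z ^+ 3 - p * t ^+ 4 * z * w ^+ 2) / (t ^+ 6 * w ^+ 3).
    by rewrite {1}e; field; rewrite t0 w0.
  by rewrite /on_curve; apply/eqP; field; rewrite t0 w0.
split; rewrite ?ez ?ew //; first exact: local2_unit.
by rewrite /= invr_neq0 // mulf_neq0 // expf_neq0.
Qed.

Lemma odd_part_natr (n : nat) : (0 < n)%N ->
  exists k m : nat, odd m /\ n%:R = 2 ^+ k * m%:R :> rat.
Proof.
move=> n0; exists (logn 2 n), (n`_2^')%N; split.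
  by rewrite odd_2'nat part_pnat.
by rewrite -natrX -natrM -p_part partnC.
Qed.

(** For P0 = (0, B), the point 2 P0 has z = 2 B A^4 / M and w = 8 B^3 / M with
    M = A^6 - 8 B^4 odd; its level is twice the 2-part of B. *)
Lemma close_point_odd (A B : nat) : odd A -> (0 < B)%N ->
  exists t P, [/\ t != 0, t / 2 \in local2,
    on_curve (- (A%:R ^+ 2)) (B%:R ^+ 2) P, close t P & zeta t P \in unit2].
Proof.
move=> oA B0; have [k [m [om ->]]] := odd_part_natr B0.
have uA := unit2_odd oA; have um := unit2_odd om.
set T := 2 ^+ k; move: (A%:R) (m%:R) uA um => a b ua ub.
have T0 : T != 0 :> rat by rewrite expf_neq0.
have TP : T \in local2 by rewrite /T; in_local2.
have aP := local2_unit ua; have bP := local2_unit ub.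
pose M := a ^+ 6 + 2 * (- 4 * (T * b) ^+ 4).
have Mu : M \in unit2.
  by apply: unit2D; [rewrite !exprS expr0 !unit2M ?unit2_odd|in_local2].
have M0 := unit2_neq0 Mu; have VP := local2_unit (unit2V Mu).
have zu : b * a ^+ 4 / M \in unit2.
  by rewrite !exprS expr0 !unit2M ?unit2V ?unit2_odd.
have wP : b ^+ 3 / M \in local2 by in_local2.
have w0 : b ^+ 3 / M != 0.
  by rewrite mulf_neq0 ?invr_neq0 ?expf_neq0 ?unit2_neq0.
have t0 : 2 * T != 0 by rewrite mulf_neq0.
have := @close_point (- (a ^+ 2)) ((T * b) ^+ 2) _ _ _ t0 w0 wP zu.
case; first by move: M0; rewrite /M => M0; field.
by move=> P [hP cP uP]; exists (2 * T), P; split=> //; rewrite mulrC mulKf.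
Qed.

(** With A = 2 g, the point 3 P0 has z = 2 B g^4 N / M and w = 8 g^12 / (B M),
    where M = B^8 - 12 g^6 B^4 + 24 g^12 and N = B^4 - 8 g^6 are odd; its level
    is twice the fourth power of the 2-part of g. *)
Lemma close_point_even (A B : nat) : (0 < A)%N -> ~~ odd A -> odd B ->
  exists t P, [/\ t != 0, t / 2 \in local2,
    on_curve (- (A%:R ^+ 2)) (B%:R ^+ 2) P, close t P & zeta t P \in unit2].
Proof.
move=> A0 eA oB; have A20 : (0 < A./2)%N by case: A A0 eA => [|[]].
have -> : A%:R = 2 * (A./2)%:R :> rat.
  by rewrite -natrM mul2n -[in LHS](odd_double_half A) (negPf eA).
have [k [m [om ->]]] := odd_part_natr A20.
have uB := unit2_odd oB; have um := unit2_odd om.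
set T := 2 ^+ k; move: (B%:R) (m%:R) uB um => b a ub ua.
have T0 : T != 0 :> rat by rewrite expf_neq0.
have TP : T \in local2 by rewrite /T; in_local2.
have aP := local2_unit ua; have bP := local2_unit ub.
pose M := b ^+ 8 + 2 * (- 6 * (T * a) ^+ 6 * b ^+ 4 + 12 * (T * a) ^+ 12).
have Mu : M \in unit2.
  by apply: unit2D; [rewrite !exprS expr0 !unit2M ?unit2_odd|in_local2].
pose N := b ^+ 4 + 2 * (- 4 * (T * a) ^+ 6).
have Nu : N \in unit2.
  by apply: unit2D; [rewrite !exprS expr0 !unit2M ?unit2_odd|in_local2].
have M0 := unit2_neq0 Mu; have VP := local2_unit (unit2V Mu).
have b0 := unit2_neq0 ub; have bVP := local2_unit (unit2V ub).
have zu : b * a ^+ 4 * N / M \in unit2.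
  by rewrite !exprS expr0 !unit2M ?unit2V ?unit2_odd.
have wP : a ^+ 12 / b / M \in local2 by in_local2.
have w0 : a ^+ 12 / b / M != 0.
  by rewrite !mulf_neq0 ?invr_neq0 ?expf_neq0 ?unit2_neq0.
have t0 : 2 * T ^+ 4 != 0 by rewrite mulf_neq0 ?expf_neq0.
have := @close_point (- ((2 * (T * a)) ^+ 2)) (b ^+ 2) _ _ _ t0 w0 wP zu.
case; first by rewrite /N; move: M0; rewrite /M => M0; field; rewrite ?M0 ?b0.
move=> P [hP cP uP]; exists (2 * T ^+ 4), P; split=> //.
by rewrite mulrC mulKf //; in_local2.
Qed.

(** * Nonsingularity and rank *)

(** For A nonzero, the 3-adic valuations of 27 B^4 and 4 A^6 have different
    parities. *)
Lemma elliptic_sqr (A B : nat) : (0 < B)%N ->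
  elliptic (- (A%:R ^+ 2)) (B%:R ^+ 2).
Proof.
move=> B0; apply/eqP => h.
have : (27 * B ^ 4 = 4 * A ^ 6)%N.
  apply/eqP; rewrite -(eqr_nat rat) (natrM _ 27) (natrM _ 4) !natrX -subr_eq0.
  by apply/eqP; rewrite -[RHS]h; ring.
have [->|A0] := posnP A; first by lia.
move/(congr1 (logn 3)).
by rewrite (lognM 3 (_ : 0 < 27)%N) ?(lognM 3 (_ : 0 < 4)%N) ?expn_gt0 ?A0 ?B0 //
  !lognX (_ : logn 3 27 = 3) // (_ : logn 3 4 = 0) //; lia.
Qed.

Lemma add_point_idem p q (P : point p q) :
  add_point P P = P -> P = zero_point p q.
Proof.
move=> /(congr1 sval) e; apply: val_inj; move: e => /=.
case: (sval P) => [[x y]|] //=; rewrite eqxx /=.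
by case: eqP => // ny [ex ey]; case: ny; rewrite -{1}ey ex subrr mulr0 add0r.
Qed.

Lemma sval_mul_point p q n (P : point p q) :
  sval (mul_point n P) = mul_coords p n (sval P).
Proof. by elim: n => //= n ->. Qed.

(** With no free part, f sends every P to a torsion point T, and n T = 0 gives
    f (n P) = f 0 since f is additive. Additivity of f also gives f 0 = 0, as 0
    is the only idempotent. *)
Lemma rank0_torsion p q :
  has_rank p q 0 -> forall P : point p q, torsion_point P.
Proof.
case=> f [fD f_inj im_f] P.
have f0 : (f (zero_point p q)).2 = zero_point p q.
  apply: add_point_idem; have := fD (zero_point p q) (zero_point p q).
  have -> : add_point (zero_point p q) (zero_point p q) = zero_point p q.
    exact: val_inj.
  by move=> /(congr1 snd).
have fM n : (f (mul_point n P)).2 = mul_point n (f P).2.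
  elim: n => [|n IH]; first exact: f0.
  by rewrite [mul_point _ P]iterS fD /= IH.
have [n n0 nT] : torsion_point (f P).2.
  by apply/(im_f (f P).1); exists P; case: (f P).
exists n => //; apply: f_inj.
rewrite [LHS]surjective_pairing [RHS]surjective_pairing fM nT f0.
by congr pair; apply/rowP => -[].
Qed.

Lemma rank_pos p q t P r : elliptic p q -> p \in local2 -> q \in local2 ->
  t != 0 -> t / 2 \in local2 -> on_curve p q P -> close t P ->
  zeta t P \in unit2 -> has_rank p q r -> (0 < r)%N.
Proof.
move=> ell hp hq t0 ht hP cP uP; case: r => // /rank0_torsion.
case/(_ (exist _ P hP)) => n n0 /(congr1 sval); rewrite sval_mul_point.
by move/(mul_close_neq0 ell hp hq t0 ht hP cP uP n0).
Qed.

(** If two sides were even, so would be the third one, against primitivity. *)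
Lemma pythagorean_not_both_even (a b c A B : nat) :
  primitive_pythagorean a b c ->
  A \in [:: a; b; c] -> B \in [:: a; b; c] -> A <> B ->
  [/\ (0 < A)%N, (0 < B)%N & odd A || odd B].
Proof.
case=> a0 b0 c0 e g hA hB nAB.
have pos x : x \in [:: a; b; c] -> (0 < x)%N.
  by rewrite !inE => /or3P[] /eqP->.
split; try exact: pos.
have odd_e : odd a (+) odd b = odd c.
  by move/(congr1 odd): e; rewrite oddD !oddX.
have ng : ~~ [&& ~~ odd a, ~~ odd b & ~~ odd c].
  apply/negP => /and3P[ha hb hc].
  have : (2 %| gcdn (gcdn a b) c)%N by rewrite !dvdn_gcd !dvdn2 ha hb hc.
  by rewrite g.
move: hA hB; rewrite !inE => /or3P[] /eqP eA /or3P[] /eqP eB;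
  move: nAB odd_e ng; rewrite eA eB //;
  by case: (odd a); case: (odd b); case: (odd c).
Qed.

Theorem mainTheorem1 (a b c A B : nat)
    (habc : primitive_pythagorean a b c)
    (hA : A \in [:: a; b; c]) (hB : B \in [:: a; b; c]) (hAB : A <> B) :
  elliptic (- (A%:R ^+ 2)) (B%:R ^+ 2) /\
  forall r : nat, has_rank (- (A%:R ^+ 2)) (B%:R ^+ 2) r -> (0 < r)%N.
Proof.
have [A0 B0 oAB] := pythagorean_not_both_even habc hA hB hAB.
have ell := elliptic_sqr A B0; split=> // r.
have [t [P [t0 ht hP cP uP]]] : exists t P, [/\ t != 0, t / 2 \in local2,
    on_curve (- (A%:R ^+ 2)) (B%:R ^+ 2) P, close t P & zeta t P \in unit2].
  have [oA|eA] := boolP (odd A); first exact: close_point_odd.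
  by apply: close_point_even; rewrite ?(negPf eA) // in oAB *.
by apply: (rank_pos ell _ _ t0 ht hP cP uP); in_local2.
Qed.
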